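(* Let $X$ be a reflexive real Banach space and let $T\subset X\times X^*$ be a maximal monotone operator. Then $T$ is non-enlargeable if and only if there exist a self-cancelling operator $A\subset X\times X^*$ and a point $(x,x^* )\in X\times X^*$ such that $A^\vdash$ is maximal monotone and \[ T=A^\vdash+\{(x,x^* )\}=\{(y+x,y^*+x^* )\mid (y,y^* )\in A^\vdash\}. \] Moreover, if $T$ is non-enlargeable and $(x,x^* )\in T$, then the maximal (with respect to inclusion) $A\subset X\times X^*$ satisfying $T-\{(x,x^* )\}=A^\vdash$ is $(T-\{(x,x^* )\})^\vdash$, where $T-\{(x,x^* )\}=\{(y-x,y^*-x^* )\mid (y,y^* )\in T\}$.
   Context: $X^*$ is the topological dual of $X$ and $\langle x,x^*\rangle=x^*(x)$. An operator $T:X\rightrightarrows X^*$ is identified with a subset of $X\times X^*$. $T$ is monotone if $\langle x-y,x^*-y^*\rangle\ge 0$ for all $(x,x^* ),(y,y^* )\in T$, and maximal monotone if it is monotone and not properly contained in any monotone operator. For a maximal monotone $T$ and $\varepsilon\ge 0$, the enlargement is $T^\varepsilon=\{(x,x^* )\mid \langle x-y,x^*-y^*\rangle\ge-\varepsilon\ \forall (y,y^* )\in T\}$; $T$ is called non-enlargeable if $T^\varepsilon=T$ for all $\varepsilon\ge0$. For $B\subset X\times X^*$, $B^\vdash=\{(y,y^* )\in X\times X^*\mid \langle x,y^*\rangle+\langle y,x^*\rangle=0\ \forall (x,x^* )\in B\}$. An operator $A\subset X\times X^*$ is self-cancelling if $A$ is a linear subspace of $X\times X^*$ and $\langle x,x^*\rangle=0$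 for all $(x,x^* )\in A$. *)

(* Defs.v *)
From HB Require Import structures.
From mathcomp Require Import all_boot all_order all_algebra.
From mathcomp Require Import all_classical all_reals all_analysis.
Set Implicit Arguments. Unset Strict Implicit. Unset Printing Implicit Defensive.
Import Order.TTheory GRing.Theory Num.Theory.
Import numFieldNormedType.Exports.
Local Open Scope classical_set_scope.
Local Open Scope ring_scope.

Section Duality.
Variables (R : realType) (X : normedModType R).

Record dual := Dual {
  dfun :> X -> R ;
  dfun_linear : forall (a : R) (x y : X), dfun (a *: x + y) = a * dfun x + dfun y ;
  dfun_cont : continuous dfun }.

Definition pairing (x : X) (xs : dual) : R := xs x.

(* reflexivity: every continuous linear functional on X^* (normed by the
   operator norm) is an evaluation at a point of X.  phi is bounded iff
   |phi f| <= C * ||f|| for all f, with ||f|| = inf{M >= 0 | |f x| <= M ||x||}. *)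
Definition dual_lincomb (a : R) (f g h : dual) := forall z, h z = a * f z + g z.

Definition bidual_bounded (phi : dual -> R) :=
  exists C : R, forall (f : dual) (M : R), 0 <= M ->
    (forall x : X, `|f x| <= M * `|x|) -> `|phi f| <= C * M.

Definition bidual_linear (phi : dual -> R) :=
  forall a f g h, dual_lincomb a f g h -> phi h = a * phi f + phi g.

Definition reflexive_space :=
  forall phi : dual -> R, bidual_linear phi -> bidual_bounded phi ->
    exists x : X, forall f : dual, phi f = f x.

Definition monotone (T : set (X * dual)) :=
  forall p q, T p -> T q ->
    0 <= pairing (p.1 - q.1) p.2 - pairing (p.1 - q.1) q.2.

Definition maximal_monotone (T : set (X * dual)) :=
  monotone T /\ forall S : set (X * dual), monotone S -> T `<=` S -> S = T.

Definition enlargement (T : set (X * dual)) (eps : R) : set (X * dual) :=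
  [set p : X * dual | forall q, T q ->
     - eps <= pairing (p.1 - q.1) p.2 - pairing (p.1 - q.1) q.2].

Definition non_enlargeable (T : set (X * dual)) :=
  forall eps : R, 0 <= eps -> enlargement T eps = T.

Definition perp (B : set (X * dual)) : set (X * dual) :=
  [set q : X * dual | forall p, B p -> pairing p.1 q.2 + pairing q.1 p.2 = 0].

Definition self_cancelling (A : set (X * dual)) :=
  (exists z, A z /\ z.1 = 0 /\ forall y, z.2 y = 0) /\
  (forall (a : R) p q r, A p -> A q ->
     r.1 = a *: p.1 + q.1 -> dual_lincomb a p.2 q.2 r.2 -> A r) /\
  (forall p, A p -> pairing p.1 p.2 = 0).

Definition translate (B : set (X * dual)) (x : X) (xs : dual) : set (X * dual) :=
  [set p : X * dual | exists q, B q /\ p.1 = q.1 + x /\ forall z, p.2 z = q.2 z + xs z].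

Definition untranslate (B : set (X * dual)) (x : X) (xs : dual) : set (X * dual) :=
  [set p : X * dual | exists q, B q /\ p.1 = q.1 - x /\ forall z, p.2 z = q.2 z - xs z].

End Duality.

(* Main.v *)
(** Write q(p) = <p.1, p.2> and let B be its polar form, so that B^⊢ is the
B-orthogonal of a set.  Translate T so that it contains 0.  If T is
non-enlargeable, a point p lies in T as soon as q(p - s) is bounded below for
s in T; expanding q shows that T is then a linear subspace.  For a in T^⊢,
q(a - s) = q(a) + q(s) >= q(a), so T^⊢ is contained in T, and
2 q(a) = B(a, a) = 0: T^⊢ is self-cancelling.  A point p outside T satisfies
q(p - s) < 0 for some s in T, hence has positive distance to T, and Hahn-Banach
with reflexivity yields an element of T^⊢ that is not B-orthogonal to p; thus
T^⊢⊢ = T.  Conversely, if A is self-cancelling then A is contained in A^⊢, and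
q(p - t a) = q(p) - t B(p, a) is bounded below in t only if B(p, a) = 0. *)
Require Import Defs.
From HB Require Import structures.
From mathcomp Require Import all_boot all_order all_algebra.
From mathcomp Require Import all_classical all_reals all_analysis.
From mathcomp Require Import ring lra.
Import Order.TTheory GRing.Theory Num.Theory.
Import numFieldNormedType.Exports.
Local Open Scope classical_set_scope.
Local Open Scope ring_scope.

(** * Hahn-Banach extension under a sublinear bound *)

Section HahnBanach.
Context {R : realType} {V : lmodType R} (N : V -> R).
Hypothesis N_add : forall u v, N (u + v) <= N u + N v.
Hypothesis N_scale : forall a v, 0 <= a -> N (a *: v) = a * N v.

Let subspace (G : set (V * R^o)) :=
  G 0 /\ forall a p q, G p -> G q -> G (a *: p + q).
Let dominated (G : set (V * R^o)) := forall v r, G (v, r) -> r <= N v.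

(* The value [c] at [v] must separate the numbers [r - N (u - v)] from the
   numbers [N (u + v) - r], where [(u, r)] runs over the graph. *)
Let extend_graph (G : set (V * R^o)) (v : V) : subspace G -> dominated G ->
  exists c : R,
    let G' := [set p | exists a q, G q /\ p = a *: (v, c : R^o) + q] in
    subspace G' /\ dominated G'.
Proof.
move=> [G0 GD] Gdom.
pose E : set R := [set s | exists u r, G (u, r) /\ s = r - N (u - v)].
(* For [(u, r)] and [(w, s)] in [G], domination at [u + w = (u + v) + (w - v)] gives
   [s - N (w - v) <= N (u + v) - r]. *)
have Eub u r : G (u, r) -> ubound E (N (u + v) - r).
  move=> Gu _ [w [s [Gw ->]]].
  have := Gdom _ _ (GD 1 _ _ Gu Gw); rewrite /= !scale1r.
  have := N_add (u + v) (w - v); rewrite addrACA subrr addr0; lra.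
have E0 : E !=set0 by exists (0 - N (0 - v)); exists 0, 0.
have Ehub : has_ubound E by exists (N (0 + v) - 0); exact: Eub.
exists (sup E) => G'; split; first split.
- by exists 0, 0; rewrite scale0r addr0.
- move=> a _ _ [b [p [Gp ->]]] [c [q [Gq ->]]].
  exists (a * b + c), (a *: p + q); split; first exact: GD.
  by rewrite scalerDr scalerA scalerDl addrACA.
- move=> _ _ [a [[u r] [Gu [-> ->]]]] /=; change (a * sup E + r <= N (a *: v + u)).
  have Gscale b : G (b *: u, b * r).
    by have := GD b _ _ Gu G0; rewrite addr0.
  (* Positive homogeneity allows division by [|a|], which reduces the coefficient of [v] to -1 or 1,
     where [sup E] meets its lower or upper constraint. *)
  have [a_lt0|a_gt0|->] := ltgtP a 0; last 1 first.
  - by rewrite mul0r scale0r !add0r; exact: Gdom.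
  - have b_gt0 : 0 < - a by rewrite oppr_gt0.
    have -> : a *: v + u = - a *: ((- a)^-1 *: u - v).
      by rewrite scalerBr scalerA divff ?gt_eqF// scale1r scaleNr opprK addrC.
    rewrite (N_scale _ _ (ltW b_gt0)).
    have : (- a)^-1 * r - N ((- a)^-1 *: u - v) <= sup E.
      by apply: ub_le_sup => //; exists ((- a)^-1 *: u), ((- a)^-1 * r).
    rewrite -(ler_pM2l b_gt0) mulrBr mulrA divff ?gt_eqF// mul1r; lra.
  - have -> : a *: v + u = a *: (a^-1 *: u + v).
      by rewrite scalerDr scalerA divff ?gt_eqF// scale1r addrC.
    rewrite (N_scale _ _ (ltW a_gt0)).
    have : sup E <= N (a^-1 *: u + v) - a^-1 * r.
      by apply: ge_sup => //; exact: Eub.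
    rewrite -(ler_pM2l a_gt0) mulrBr mulrA divff ?gt_eqF// mul1r; lra.
Qed.

(** Partial functionals are handled as graphs. A maximal dominated graph given by Zorn's lemma is
    total by the one-step extension. It is single-valued because [(0, r)] in the graph forces both
    [r] and [-r] below [N 0 = 0]. *)
Lemma hahn_banach_graph (G : set (V * R^o)) :
  G 0 -> (forall a p q, G p -> G q -> G (a *: p + q)) ->
  (forall v r, G (v, r) -> r <= N v) ->
  exists F : V -> R, [/\ forall a u v, F (a *: u + v) = a * F u + F v,
    forall v, F v <= N v & forall v r, G (v, r) -> F v = r].
Proof.
move=> G0 GD Gdom.
(* Joining [G] to every candidate lets the empty chain satisfy [P]. *)
pose P (H : set (V * R^o)) := subspace (H `|` G) /\ dominated (H `|` G).
have [|H [[[HG0 HGD] HGdom] Hmax]] := @Zorn_bigcup _ P.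
  move=> C CP Ctot.
  (* Being a dominated subspace concerns at most two points at a time, so it passes to the union
     once any two points lie in a common [H] joined with [G], or both in [G]. *)
  have common p q : (\bigcup_(H in C) H `|` G) p ->
      (\bigcup_(H in C) H `|` G) q ->
      G p /\ G q \/ exists2 H, C H & (H `|` G) p /\ (H `|` G) q.
    move=> [[H CH Hp]|Gp] [[K CK Kq]|Gq].
    - have [HK|KH] := Ctot _ _ CH CK; right.
        by exists K => //; split; left => //; exact: HK.
      by exists H => //; split; left => //; exact: KH.
    - by right; exists H => //; split; [left|right].
    - by right; exists K => //; split; [right|left].
    - by left.
  have sub H : C H -> (H `|` G) `<=` (\bigcup_(K in C) K `|` G).
    by move=> CH p [Hp|Gp]; [left; exists H|right].
  split; first split; first by right.
  - move=> a p q Hp Hq; have [[Gp Gq]|[H CH [{}Hp {}Hq]]] := common _ _ Hp Hq.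
      by right; exact: GD.
    by apply: (sub H CH); exact: (CP _ CH).1.2.
  - move=> v r [[H CH Hv]|Gv]; last exact: Gdom.
    by apply: (CP _ CH).2; left.
have total v : exists r, (H `|` G) (v, r).
  have [c [G'sub G'dom]] := extend_graph _ v (conj HG0 HGD) HGdom.
  set G' := (X in subspace X) in G'sub G'dom.
  have HG' : (H `|` G) `<=` G'.
    by move=> p Hp; exists 0, p; rewrite scale0r add0r.
  have G'v : G' (v, c) by exists 1, 0; rewrite scale1r addr0.
  exists c; apply: contrapT => nHG; apply: (Hmax G').
    split; first by move=> p Hp; apply: HG'; left.
    by move=> G'H; apply: nHG; left; exact: G'H.
  by rewrite /P setUidl// => p Gp; apply: HG'; right.
have N0 : N 0 = 0 by rewrite -(scale0r (0 : V)) N_scale// mul0r.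
have zero r : (H `|` G) (0, r) -> r = 0.
  move=> H0r; apply/eqP; rewrite eq_le; apply/andP; split.
    by have := HGdom _ _ H0r; rewrite N0.
  have := HGD (-1) _ _ H0r HG0; rewrite addr0 => /HGdom /=.
  by rewrite scaler0 N0 scaleN1r oppr_le0.
have uniq v r s : (H `|` G) (v, r) -> (H `|` G) (v, s) -> r = s.
  move=> Hr Hs; have := HGD (-1) _ _ Hr Hs.
  have -> : -1 *: (v, r : R^o) + (v, s : R^o) = (0, (s - r : R^o)).
    by rewrite scaleN1r; congr pair => /=; rewrite ?addNr// addrC.
  by move=> /zero /subr0_eq.
have [F FP] := choice total; exists F; split.
- by move=> a u v; apply: (uniq (a *: u + v)) (HGD _ _ _ (FP u) (FP v)); exact: FP.
- by move=> v; exact: HGdom.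
- by move=> v r Gv; apply: uniq (FP v) _; right.
Qed.

End HahnBanach.

(** * The dual as a vector space with the operator norm *)

Section DualModule.
Context {R : realType} {X : normedModType R}.
Implicit Types f g : dual X.

(** Proof irrelevance identifies the proof fields, so the module axioms below hold as equalities in
    [dual X]. *)
Lemma dual_ext f g : (forall x, f x = g x) -> f = g.
Proof.
case: f g => [f f1 f2] [g g1 g2] /= /funext fg; move: f1 f2 g1 g2.
by rewrite fg => f1 f2 g1 g2; congr Dual; exact: Prop_irrelevance.
Qed.

Lemma dual_zero_linear (a : R) (x y : X) : 0 = a * 0 + 0 :> R.
Proof. by rewrite mulr0 addr0. Qed.

Definition dual_zero : dual X :=
  Dual dual_zero_linear (@cst_continuous X R 0).

Lemma dual_opp_linear f (a : R) (x y : X) :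
  - f (a *: x + y) = a * - f x + - f y.
Proof. by rewrite dfun_linear; ring. Qed.

Lemma dual_opp_cont f : continuous (fun x => - f x).
Proof. by move=> x; apply: cvgN; exact: dfun_cont. Qed.

Definition dual_opp f := Dual (dual_opp_linear f) (dual_opp_cont f).

Lemma dual_add_linear f g (a : R) (x y : X) :
  f (a *: x + y) + g (a *: x + y) = a * (f x + g x) + (f y + g y).
Proof. by rewrite !dfun_linear; ring. Qed.

Lemma dual_add_cont f g : continuous (fun x => f x + g x).
Proof. by move=> x; apply: cvgD; exact: dfun_cont. Qed.

Definition dual_add f g := Dual (dual_add_linear f g) (dual_add_cont f g).

Lemma dual_scale_linear (b : R) f (a : R) (x y : X) :
  b * f (a *: x + y) = a * (b * f x) + b * f y.
Proof. by rewrite dfun_linear; ring. Qed.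

Lemma dual_scale_cont (b : R) f : continuous (fun x => b * f x).
Proof. by move=> x; apply: cvgM; [exact: cvg_cst|exact: dfun_cont]. Qed.

Definition dual_scale (b : R) f :=
  Dual (dual_scale_linear b f) (dual_scale_cont b f).

HB.instance Definition _ := gen_eqMixin (dual X).
HB.instance Definition _ := gen_choiceMixin (dual X).

Lemma dual_addA : associative dual_add.
Proof. by move=> f g h; apply: dual_ext => x /=; rewrite addrA. Qed.

Lemma dual_addC : commutative dual_add.
Proof. by move=> f g; apply: dual_ext => x /=; rewrite addrC. Qed.

Lemma dual_add0 : left_id dual_zero dual_add.
Proof. by move=> f; apply: dual_ext => x /=; rewrite add0r. Qed.

Lemma dual_addN : left_inverse dual_zero dual_opp dual_add.
Proof. by move=> f; apply: dual_ext => x /=; rewrite addNr. Qed.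

HB.instance Definition _ := GRing.isZmodule.Build (dual X)
  dual_addA dual_addC dual_add0 dual_addN.

Lemma dual_scaleA (a b : R) f :
  dual_scale a (dual_scale b f) = dual_scale (a * b) f.
Proof. by apply: dual_ext => x /=; rewrite mulrA. Qed.

Lemma dual_scale1 : left_id 1 dual_scale.
Proof. by move=> f; apply: dual_ext => x /=; rewrite mul1r. Qed.

Lemma dual_scaleDr : right_distributive dual_scale +%R.
Proof. by move=> a f g; apply: dual_ext => x /=; rewrite mulrDr. Qed.

Lemma dual_scaleDl f : {morph dual_scale^~ f : a b / a + b}.
Proof. by move=> a b; apply: dual_ext => x /=; rewrite mulrDl. Qed.

HB.instance Definition _ := GRing.Zmodule_isLmodule.Build R (dual X)
  dual_scaleA dual_scale1 dual_scaleDr dual_scaleDl.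

HB.instance Definition _ f := GRing.isLinear.Build R X R^o *:%R f (dfun_linear f).

Lemma dual_addE f g x : (f + g) x = f x + g x. Proof. by []. Qed.
Lemma dual_oppE f x : (- f) x = - f x. Proof. by []. Qed.
Lemma dual_scaleE (a : R) f x : (a *: f) x = a * f x. Proof. by []. Qed.
Lemma dual_zeroE x : (0 : dual X) x = 0. Proof. by []. Qed.

Definition dualE := (dual_addE, dual_oppE, dual_scaleE, dual_zeroE).

Lemma dfunD f x y : f (x + y) = f x + f y.
Proof. exact: (linearD f). Qed.

Lemma dfunN f x : f (- x) = - f x.
Proof. exact: (linearN f). Qed.

Lemma dfunZ f (a : R) x : f (a *: x) = a * f x.
Proof. exact: (linearZ_LR f). Qed.

Lemma dfun0 f : f 0 = 0.
Proof. exact: (linear0 f). Qed.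

Definition dfunE := (dfunD, dfunN, dfunZ, dfun0).

Definition dual_norm f : R :=
  inf [set M : R | 0 <= M /\ forall x : X, `|f x| <= M * `|x|].

Lemma dual_norm_le f (M : R) :
  0 <= M -> (forall x, `|f x| <= M * `|x|) -> dual_norm f <= M.
Proof. by move=> M0 fM; apply: ge_inf => //; exists 0 => ? []. Qed.

(** A continuous linear functional is bounded, so the infimum defining [dual_norm] is taken over a
    nonempty set. *)
Lemma dual_bounds_nonempty f :
  [set M : R | 0 <= M /\ forall x : X, `|f x| <= M * `|x|] !=set0.
Proof.
have /linear_bounded_continuous/linear_boundedP : continuous f by exact: dfun_cont.
by move=> /pinfty_ex_gt0[M M0 fM]; exists M; split => //; exact: ltW.
Qed.

Lemma dual_norm_ge0 f : 0 <= dual_norm f.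
Proof.
by apply: lb_le_inf; [exact: dual_bounds_nonempty|move=> M []].
Qed.

Lemma le_dual_norm f x : `|f x| <= dual_norm f * `|x|.
Proof.
have [->|x0] := eqVneq x 0; first by rewrite dfun0 !normr0 mulr0.
rewrite -ler_pdivrMr ?normr_gt0//.
apply: lb_le_inf; first exact: dual_bounds_nonempty.
by move=> M [_ fM]; rewrite ler_pdivrMr ?normr_gt0.
Qed.

Lemma dual_normD f g : dual_norm (f + g) <= dual_norm f + dual_norm g.
Proof.
apply: dual_norm_le => [|x]; first by rewrite addr_ge0 ?dual_norm_ge0.
by rewrite mulrDl (le_trans (ler_normD _ _))// lerD ?le_dual_norm.
Qed.

Lemma dual_normZ (a : R) f : dual_norm (a *: f) = `|a| * dual_norm f.
Proof.
have le b g : dual_norm (b *: g) <= `|b| * dual_norm g.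
  apply: dual_norm_le => [|x]; first by rewrite mulr_ge0 ?dual_norm_ge0.
  by rewrite dualE normrM -mulrA ler_wpM2l ?le_dual_norm.
apply/eqP; rewrite eq_le le /=; have [->|a0] := eqVneq a 0.
  by rewrite normr0 mul0r dual_norm_ge0.
(* The reverse inequality is the one just proved, applied to [a^-1] and [a *: f]. *)
rewrite -ler_pdivlMl ?normr_gt0// -normfV.
by rewrite -{1}[f]scale1r -(mulVf a0) -scalerA le.
Qed.

Lemma dual_of_bounded (F : X -> R) (C : R) :
  (forall (a : R) x y, F (a *: x + y) = a * F x + F y) ->
  (forall x, `|F x| <= C * `|x|) -> exists f : dual X, f =1 F.
Proof.
move=> Flin FC.
pose L : {linear X -> R^o} := HB.pack F (GRing.isLinear.Build R X R^o *:%R F Flin).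
have Fcont : continuous (L : X -> R).
  apply: bounded_linear_continuous; apply/linear_boundedP.
  near=> r => x; apply: le_trans (FC x) _.
  by apply: ler_wpM2r => //; near: r; apply: nbhs_pinfty_ge; exact: num_real.
by exists (Dual Flin Fcont).
Unshelve. all: by end_near. Qed.

End DualModule.

(** * The duality product [quad], its [polar] form, orthogonality and translation *)

Section Operators.
Context {R : realType} {X : normedModType R}.
Local Notation V := (X * dual X)%type.
Implicit Types (p q r s : V) (T A B : set V).

Definition quad p : R := pairing p.1 p.2.
Definition polar p q : R := pairing p.1 q.2 + pairing q.1 p.2.

Lemma quadD p q : quad (p + q) = quad p + polar p q + quad q.
Proof.
case: p q => [x f] [y g]; rewrite /quad /polar /pairing /= ?dualE !dfunE; ring.
Qed.

Lemma quadZ (a : R) p : quad (a *: p) = a ^+ 2 * quad p.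
Proof. by case: p => [x f]; rewrite /quad /pairing /= ?dualE dfunE; ring. Qed.

Lemma quadN p : quad (- p) = quad p.
Proof. by rewrite -scaleN1r quadZ; ring. Qed.

Lemma quad0 : quad 0 = 0.
Proof. by rewrite -(scale0r (0 : V)) quadZ expr2 !mul0r. Qed.

Lemma polarC p q : polar p q = polar q p.
Proof. by rewrite /polar addrC. Qed.

Lemma polarDl p q r : polar (p + q) r = polar p r + polar q r.
Proof.
case: p q r => [x f] [y g] [z h]; rewrite /polar /pairing /= ?dualE !dfunE; ring.
Qed.

Lemma polarZl (a : R) p q : polar (a *: p) q = a * polar p q.
Proof.
by case: p q => [x f] [y g]; rewrite /polar /pairing /= ?dualE dfunE; ring.
Qed.

Lemma polarNl p q : polar (- p) q = - polar p q.
Proof. by rewrite -scaleN1r polarZl mulN1r. Qed.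

Lemma polar0l q : polar 0 q = 0.
Proof. by rewrite -(scale0r (0 : V)) polarZl mul0r. Qed.

Lemma polarDr p q r : polar r (p + q) = polar r p + polar r q.
Proof. by rewrite polarC polarDl !(polarC r). Qed.

Lemma polarZr (a : R) p q : polar q (a *: p) = a * polar q p.
Proof. by rewrite polarC polarZl polarC. Qed.

Lemma polarNr p q : polar q (- p) = - polar q p.
Proof. by rewrite polarC polarNl polarC. Qed.

Lemma polar0r q : polar q 0 = 0.
Proof. by rewrite polarC polar0l. Qed.

Definition polarE := (polarDl, polarDr, polarNl, polarNr, polarZl, polarZr).
Lemma quadB p q : quad (p - q) = quad p - polar p q + quad q.
Proof. by rewrite quadD quadN polarNr. Qed.

Definition quadE := (quadD, quadN, quadZ, polarE).

(** Turns monotonicity and membership in an enlargement into lower bounds on [quad] of a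
    difference. *)
Lemma pairingB p q :
  pairing (p.1 - q.1) p.2 - pairing (p.1 - q.1) q.2 = quad (p - q).
Proof. by case: p q => [x f] [y g]; rewrite /quad /pairing /= ?dualE. Qed.

Lemma monotoneE T : Defs.monotone T = forall p q, T p -> T q -> 0 <= quad (p - q).
Proof.
by apply: propext; split=> mT p q Tp Tq; have := mT p q Tp Tq; rewrite pairingB.
Qed.

Lemma enlargementP T (e : R) p :
  enlargement T e p <-> forall q, T q -> - e <= quad (p - q).
Proof. by split=> Tp q Tq; have := Tp q Tq; rewrite pairingB. Qed.

Lemma translateE B (x : X) (f : dual X) p : translate B x f p <-> B (p - (x, f)).
Proof.
split=> [[q [Bq [px pf]]]|Bp].
  suff -> : p - (x, f) = q by [].
  case: p q px pf Bq => [y g] [z h] /= -> gE _; congr pair => /=.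
    by rewrite addrK.
  by apply: dual_ext => w; rewrite !dualE gE addrK.
exists (p - (x, f)); split => //=; split=> [|z]; first by rewrite subrK.
by rewrite subrK.
Qed.

Lemma untranslate_translate B (x : X) (f : dual X) :
  untranslate B x f = translate B (- x) (- f).
Proof. by apply/seteqP; split=> q [r [? [? ?]]]; exists r. Qed.

Lemma untranslateE B (x : X) (f : dual X) p :
  untranslate B x f p <-> B (p + (x, f)).
Proof.
rewrite untranslate_translate translateE.
by have -> : p - (- x, - f) = p + (x, f) by rewrite -[(- x, - f)]/(- (x, f)) opprK.
Qed.

Lemma perp_linear B (a : R) p q : perp B p -> perp B q -> perp B (a *: p + q).
Proof.
move=> Bp Bq r Br; rewrite -/(polar r _) !polarE.
by rewrite [polar r p]Bp// [polar r q]Bq// mulr0 addr0.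
Qed.

Lemma perp0 B : perp B 0.
Proof. by move=> r _; exact: polar0r. Qed.

Lemma perp_self_cancelling B :
  (forall p, perp B p -> quad p = 0) -> self_cancelling (perp B).
Proof.
move=> qB; split; first by exists 0; split; [exact: perp0|].
split=> [a p q [x f] Bp Bq /= xE fE|]; last exact: qB.
suff -> : (x, f) = a *: p + q by exact: perp_linear.
by congr pair => //; apply: dual_ext => z; exact: fE.
Qed.

Lemma self_cancelling_linear A (a : R) p q :
  self_cancelling A -> A p -> A q -> A (a *: p + q).
Proof. by move=> [_ [lin _]] Ap Aq; apply: lin Ap Aq _ _. Qed.

Lemma self_cancelling_zero A : self_cancelling A -> A 0.
Proof.
move=> [[[x f] [Az [/= x0 f0]]] _]; suff -> : (0 : V) = (x, f) by [].
by rewrite x0; congr pair; apply: dual_ext => y; rewrite f0.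
Qed.

(** Polarization: [quad] vanishes at [p], [q] and [p + q], hence [polar p q = 0]. *)
Lemma self_cancelling_perp A : self_cancelling A -> A `<=` perp A.
Proof.
move=> scA p Ap q Aq; have := self_cancelling_linear _ 1 _ _ scA Ap Aq.
case: scA => _ [_ q0] /q0; rewrite scale1r -/(quad _) quadD.
by rewrite [quad p]q0// [quad q]q0// add0r addr0 polarC.
Qed.

Lemma perp_non_enlargeable A : self_cancelling A ->
  maximal_monotone (perp A) -> non_enlargeable (perp A).
Proof.
move=> scA [mA _] e e0; apply/seteqP; split=> p; last first.
  move=> Ap; apply/enlargementP => q Aq; apply: le_trans (_ : 0 <= _).
    by rewrite oppr_le0.
  by move: mA; rewrite monotoneE; apply.
move=> /enlargementP pe a Aa; rewrite -/(polar a p); apply/eqP.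
have qa : quad a = 0 by case: scA => _ [_]; exact.
have ub (t : R) : t * polar a p <= quad p + e.
  have ta : perp A (t *: a).
    apply: self_cancelling_perp => //; rewrite -[_ *: _]addr0.
    exact: self_cancelling_linear _ _ _ (self_cancelling_zero _ scA).
  have := pe _ ta; rewrite !quadE qa (polarC p a); lra.
apply: contrapT => /negP apn0.
(* At this value of [t] the bound reads [quad p + e + 1 <= quad p + e]. *)
have := ub ((quad p + e + 1) / polar a p); rewrite divfK//; lra.
Qed.

(** Enlargements depend only on differences [p - q], so they commute with translation. *)
Lemma non_enlargeable_translate T (x : X) (f : dual X) :
  non_enlargeable T -> non_enlargeable (translate T x f).
Proof.
move=> neT e e0; apply/seteqP; split=> p.
  move=> /enlargementP pe; apply/translateE; rewrite -(neT e e0).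
  apply/enlargementP => q Tq; rewrite -addrA -opprD [(x, f) + q]addrC.
  by apply: pe; apply/translateE; rewrite addrK.
move=> /translateE; rewrite -{1}(neT e e0) => /enlargementP pe.
apply/enlargementP => q /translateE Tq; have := pe _ Tq.
by rewrite opprB addrA subrK.
Qed.

End Operators.

(** * Linearity of a non-enlargeable monotone operator containing 0 *)

Section NonEnlargeable.
Context {R : realType} {X : normedModType R} (T : set (X * dual X)).
Hypotheses (neT : non_enlargeable T) (mT : Defs.monotone T) (T0 : T 0).

Let mono p q : T p -> T q -> 0 <= quad (p - q).
Proof. by move: mT; rewrite monotoneE; apply. Qed.

(** The membership test behind all closure properties: a lower bound on [quad (p - q)] uniform in
    [q] puts [p] in [T]. The absolute value makes any real [c] admissible. *)
Let mem (c : R) p : (forall q, T q -> - `|c| <= quad (p - q)) -> T p.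
Proof. by move=> pc; rewrite -(neT _ (normr_ge0 c)); exact/enlargementP. Qed.

Let quad_ge0 p : T p -> 0 <= quad p.
Proof. by move=> Tp; rewrite -[p]subr0; exact: mono. Qed.

(** The identity [quad (a *: p - q) = a * quad (p - q) + (1 - a) * quad q - a * (1 - a) * quad p]
    bounds the left side below by [- quad p]. *)
Let scale01 (a : R) p : 0 <= a <= 1 -> T p -> T (a *: p).
Proof.
move=> /andP[a0 a1] Tp; apply: (mem (quad p)) => q Tq.
have := mono _ _ Tp Tq; have := quad_ge0 _ Tp; have := quad_ge0 _ Tq.
rewrite !quadE => q0 p0 pq; rewrite ger0_norm//; nra.
Qed.

(** For [a >= 1] the factor moves to the other point: [a *: p - q = a *: (p - a^-1 *: q)], and
    [a^-1 *: q] is in [T] by the case of factors in [0, 1]. *)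
Let scale_ge0 (a : R) p : 0 <= a -> T p -> T (a *: p).
Proof.
move=> a0 Tp; have [a1|/ltW a1] := leP a 1; first by apply: scale01; rewrite ?a0.
have a_gt0 : 0 < a by exact: lt_le_trans a1.
apply: (mem 0) => q Tq; rewrite normr0 oppr0.
have -> : a *: p - q = a *: (p - a^-1 *: q).
  by rewrite scalerBr scalerA divff ?scale1r// gt_eqF.
rewrite quadZ mulr_ge0 ?sqr_ge0//; apply: mono => //; apply: scale01 => //.
by rewrite invr_ge0 a0 invf_le1.
Qed.

(** The point [p + q - r] is the midpoint of [2 *: p - r] and [2 *: q - r], where [quad] is
    nonnegative. By the parallelogram identity, [quad] at the midpoint is the average of these two
    values minus [quad (p - q)], whence the constant. *)
Let addT p q : T p -> T q -> T (p + q).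
Proof.
move=> Tp Tq; apply: (mem (polar p q - quad p - quad q)) => r Tr.
have := mono _ _ (scale_ge0 2 p _ Tp) Tr; have := mono _ _ (scale_ge0 2 q _ Tq) Tr.
rewrite !quadE => /(_ ltac:(lra)) qr /(_ ltac:(lra)) pr.
have := ler_norm (- (polar p q - quad p - quad q)); rewrite normrN; lra.
Qed.

(** Up to sign [- p - q] is [p + q], a point of [T], and [quad] is even. *)
Let oppT p : T p -> T (- p).
Proof.
move=> Tp; apply: (mem 0) => q Tq; rewrite normr0 oppr0 -opprD quadN.
exact/quad_ge0/addT.
Qed.

Lemma non_enlargeable_linear (a : R) p q : T p -> T q -> T (a *: p + q).
Proof.
move=> Tp Tq; apply: addT => //; have [a0|/ltW a0] := leP 0 a.
  exact: scale_ge0.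
by rewrite -[a *: p]opprK -scaleNr; apply/oppT/scale_ge0; rewrite ?oppr_ge0.
Qed.

Lemma perp_sub_non_enlargeable : perp T `<=` T.
Proof.
move=> p Tp; apply: (mem (quad p)) => q Tq.
have := quad_ge0 _ Tq; have := ler_norm (- quad p); rewrite normrN.
by rewrite !quadE (polarC p q) [polar q p]Tp//; lra.
Qed.

Lemma perp_non_enlargeable_self_cancelling : self_cancelling (perp T).
Proof.
apply: perp_self_cancelling => p Tp.
have := Tp p (perp_sub_non_enlargeable _ Tp).
by rewrite /quad; lra.
Qed.

End NonEnlargeable.

(** * Separation of a point from a subspace, and the biorthogonal in a reflexive space *)

Lemma separate_point {R : realType} {V : lmodType R} (N : V -> R)
  (D : set V) (v0 : V) (d : R) :
  (forall u v, N (u + v) <= N u + N v) ->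
  (forall a v, N (a *: v) = `|a| * N v) ->
  D 0 -> (forall a u v, D u -> D v -> D (a *: u + v)) ->
  0 < d -> (forall v, D v -> d <= N (v0 - v)) ->
  exists F : V -> R, [/\ forall a u v, F (a *: u + v) = a * F u + F v,
    forall v, `|F v| <= d^-1 * N v, forall v, D v -> F v = 0 & F v0 = 1].
Proof.
move=> ND NZ D0 DD d0 dist.
have NN v : N (- v) = N v by rewrite -scaleN1r NZ normrN1 mul1r.
have N_ge0 v : 0 <= N v.
  have := ND v (- v); rewrite subrr NN -(scale0r (0 : V)) NZ normr0; lra.
(* The graph of [a *: v0 + v |-> a] on the span of [v0] and [D]. It is dominated by [d^-1 * N]:
   trivially for [a <= 0], and for [a > 0] because [N (a *: v0 + v)] is [a] times the [N]-distance
   from [v0] to the point [- a^-1 *: v] of [D]. *)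
pose G : set (V * R^o) := [set p | exists a v, D v /\ p = (a *: v0 + v, a : R^o)].
have [|||||F [Flin FN FG]] := @hahn_banach_graph _ _ (fun v => d^-1 * N v) _ _ G.
- by move=> u v; rewrite -mulrDr ler_pM2l ?invr_gt0.
- by move=> a v a0; rewrite NZ ger0_norm// mulrCA.
- by exists 0, 0; rewrite scale0r addr0.
- move=> a _ _ [b [u [Du ->]]] [c [v [Dv ->]]].
  exists (a * b + c), (a *: u + v); split; first exact: DD.
  by congr pair => /=; rewrite scalerDr scalerA scalerDl addrACA.
- move=> _ _ [a [v [Dv [-> ->]]]]; rewrite ler_pdivlMl//.
  have [a0|a0] := leP a 0; first by apply: le_trans (N_ge0 _); rewrite pmulr_rle0.
  have -> : a *: v0 + v = a *: (v0 - - a^-1 *: v).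
    by rewrite scalerBr scalerA mulrN divff ?gt_eqF// scaleN1r opprK.
  rewrite NZ gtr0_norm// mulrC ler_pM2l//; apply: dist.
  by rewrite -[_ *: v]addr0; exact: DD.
exists F; split => //.
- have F0 : F 0 = 0 by apply: FG; exists 0, 0; rewrite scale0r addr0.
  move=> v; rewrite ler_norml FN andbT lerNl -NN; apply: le_trans (FN (- v)).
  have := Flin (-1) v 0; rewrite addr0 scaleN1r F0; lra.
- by move=> v Dv; apply: FG; exists 0, v; rewrite scale0r add0r.
- by apply: FG; exists 1, 0; rewrite scale1r addr0.
Qed.

Section Reflexive.
Context {R : realType} {X : normedModType R}.
Local Notation V := (X * dual X)%type.

(** The sum norm restricts to the given norm on each factor and bounds [polar] with constant 1. *)
Definition prod_norm (p : V) : R := `|p.1| + dual_norm p.2.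

Lemma prod_normD p q : prod_norm (p + q) <= prod_norm p + prod_norm q.
Proof. by rewrite /prod_norm addrACA lerD ?ler_normD ?dual_normD. Qed.

Lemma prod_normZ (a : R) p : prod_norm (a *: p) = `|a| * prod_norm p.
Proof. by rewrite /prod_norm normrZ dual_normZ mulrDr. Qed.

Lemma prod_norm_ge0 p : 0 <= prod_norm p.
Proof. by rewrite addr_ge0 ?dual_norm_ge0. Qed.

Lemma le_polar_norm p q : `|polar p q| <= prod_norm p * prod_norm q.
Proof.
have := le_dual_norm q.2 p.1; have := le_dual_norm p.2 q.1.
have := dual_norm_ge0 q.2; have := dual_norm_ge0 p.2.
have := normr_ge0 p.1; have := normr_ge0 q.1.
rewrite /polar /prod_norm /pairing => *; apply: le_trans (ler_normD _ _) _; nra.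
Qed.

(** By reflexivity the dual of the product is the product with its factors exchanged: [F] restricts
    to some [g] on [X] and to evaluation at some [y] on [dual X], and [r = (y, g)]. *)
Lemma bounded_functional_polar (hX : reflexive_space X) (F : V -> R) (C : R) :
  (forall a p q, F (a *: p + q) = a * F p + F q) ->
  (forall p, `|F p| <= C * prod_norm p) ->
  exists r, forall p, F p = polar r p.
Proof.
move=> Flin FC.
have norm0 : dual_norm (0 : dual X) = 0.
  by rewrite -(scale0r (0 : dual X)) dual_normZ normr0 mul0r.
have [||g gE] := @dual_of_bounded _ X (fun x => F (x, 0)) C.
- by move=> a x y; rewrite -Flin; congr (F (_, _)); rewrite /= scaler0 addr0.
- by move=> x; have := FC (x, 0); rewrite /prod_norm /= norm0 addr0.
have [||y yE] := hX (fun f => F (0, f)).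
- move=> a f g' h hE; rewrite -Flin; congr (F (_, _)).
    by rewrite /= scaler0 addr0.
  by apply: dual_ext => z; rewrite hE.
- have C0 : 0 <= `|C| by [].
  (* Passing to [|C|] makes the constant nonnegative, so [dual_norm f] may be replaced by any larger
     admissible bound [M]. *)
  exists `|C| => f M M0 fM; apply: le_trans (FC _) _.
  rewrite /prod_norm normr0 add0r; apply: le_trans (ler_norm _) _.
  by rewrite normrM ler_wpM2l// ger0_norm ?dual_norm_ge0// dual_norm_le.
exists (y, g) => -[x f]; rewrite /polar /pairing /= -yE gE -[F (0, f)]mul1r addrC.
rewrite addrC -Flin scale1r; congr (F (_, _)) => /=; first by rewrite add0r.
by rewrite addr0.
Qed.

Lemma non_enlargeable_biperp (hX : reflexive_space X) (T : set V) :
  non_enlargeable T -> Defs.monotone T -> T 0 -> perp (perp T) `<=` T.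
Proof.
move=> neT mT T0 p ppT; apply: contrapT => nTp.
have mono u v : T u -> T v -> 0 <= quad (u - v).
  by move: mT; rewrite monotoneE; apply.
have [s Ts ps] : exists2 s, T s & quad (p - s) < 0.
  apply: contrapT => nex; apply: nTp; rewrite -(neT 0 (lexx _)).
  apply/enlargementP => q Tq; rewrite oppr0 leNgt; apply/negP => pq.
  by apply: nex; exists q.
(* If [u = p - t] had norm below [d], then [t - s = w - u] and [quad (w - u) <= quad w + (prod_norm
   w + 1) * prod_norm u < 0], against monotonicity. The bound 1 in [d] makes the square of the norm
   of [u] at most that norm, so the added 1 absorbs [quad u]. *)
set w := p - s in ps; pose d := Num.min 1 (- quad w / (prod_norm w + 1)).
have w0 : 0 < prod_norm w + 1 by rewrite ltr_wpDl ?prod_norm_ge0.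
have d0 : 0 < d by rewrite lt_min ltr01 divr_gt0 ?oppr_gt0.
have dist t : T t -> d <= prod_norm (p - t).
  move=> Tt; rewrite leNgt lt_min; apply/negP => /andP[].
  set u := p - t; rewrite ltr_pdivlMr// => u1 uw.
  have := mono _ _ Tt Ts.
  have -> : t - s = w - u by rewrite /w /u opprB [RHS]addrC addrA subrK.
  have := le_polar_norm w u; have := le_polar_norm u u.
  rewrite quadB !ler_norml => /andP[_ uu] /andP[wu _].
  have uu1 : prod_norm u * prod_norm u <= prod_norm u.
    by rewrite ler_piMr ?prod_norm_ge0// ltW.
  have : polar u u = 2 * quad u by rewrite /polar /quad; lra.
  have := prod_norm_ge0 u; lra.
have [F [Flin FN FT Fp]] := separate_point _ _ _ _ prod_normD prod_normZ T0
  (non_enlargeable_linear T neT mT T0) d0 dist.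
have [r rE] := bounded_functional_polar hX _ _ Flin FN.
have : perp T r by move=> t Tt; rewrite -/(polar t r) polarC -rE FT.
move=> /ppT; rewrite -/(polar r p) -rE Fp => /eqP; by rewrite oner_eq0.
Qed.

End Reflexive.

(** * Reduction to operators containing 0, and the characterization *)

Section Main.
Context {R : realType} {X : normedModType R}.
Implicit Types T : set (X * dual X).

Lemma translateK T (x : X) (f : dual X) : translate (untranslate T x f) x f = T.
Proof.
apply/seteqP; split=> p.
  by move=> /translateE/untranslateE; rewrite subrK.
by move=> Tp; apply/translateE/untranslateE; rewrite subrK.
Qed.

Lemma untranslate_monotone T (x : X) (f : dual X) :
  Defs.monotone T -> Defs.monotone (untranslate T x f).
Proof.
rewrite !monotoneE => mT p q /untranslateE Tp /untranslateE Tq.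
by have := mT _ _ Tp Tq; rewrite opprD addrACA subrr addr0.
Qed.

(** The empty operator is properly contained in the monotone operator {0}. *)
Lemma maximal_monotone_nonempty T : maximal_monotone T -> exists p, T p.
Proof.
move=> [_ maxT]; apply: contrapT => nT.
have m0 : Defs.monotone [set (0 : X * dual X)].
  by rewrite monotoneE => _ _ -> ->; rewrite subrr quad0.
have := maxT _ m0 (fun p Tp => False_ind _ (nT (ex_intro _ p Tp))).
by move=> T0; apply: nT; exists 0; rewrite -T0.
Qed.

(** A monotone extension of the translated operator, moved back, is a monotone extension of [T]. *)
Lemma untranslate_maximal_monotone T (x : X) (f : dual X) :
  maximal_monotone T -> maximal_monotone (untranslate T x f).
Proof.
move=> [mT maxT]; split; first exact: untranslate_monotone.
move=> S mS TS; have <- : translate S x f = T.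
  apply: maxT; last by move=> p Tp; apply/translateE/TS/untranslateE; rewrite subrK.
  move: mS; rewrite !monotoneE => mS p q /translateE Sp /translateE Sq.
  by have := mS _ _ Sp Sq; rewrite opprB addrA subrK.
apply/seteqP; split=> p.
  by move=> Sp; apply/untranslateE/translateE; rewrite addrK.
by move=> /untranslateE/translateE; rewrite addrK.
Qed.

(** Subtracting a point of [T] brings 0 into the operator, where the linear results apply. The
    inclusion in the biorthogonal is the symmetry of [polar]. *)
Lemma untranslate_biperp (hX : reflexive_space X) T (x : X) (f : dual X) :
  Defs.monotone T -> non_enlargeable T -> T (x, f) ->
  perp (perp (untranslate T x f)) = untranslate T x f /\
  self_cancelling (perp (untranslate T x f)).
Proof.
move=> mT neT Txf; set U := untranslate T x f.
have U0 : U 0 by apply/untranslateE; rewrite add0r.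
have mU : Defs.monotone U by exact: untranslate_monotone.
have neU : non_enlargeable U.
  by rewrite /U untranslate_translate; exact: non_enlargeable_translate.
split; last exact: perp_non_enlargeable_self_cancelling.
apply/seteqP; split; first exact: non_enlargeable_biperp.
by move=> p Up q pq; rewrite -/(polar q p) polarC; exact: pq.
Qed.

End Main.

Theorem theorem1 (R : realType) (X : completeNormedModType R)
  (hX : reflexive_space X) (T : set (X * dual X)) (hT : maximal_monotone T) :
  (non_enlargeable T <->
     exists (A : set (X * dual X)) (x : X) (xs : dual X),
       [/\ self_cancelling A, maximal_monotone (perp A) & T = translate (perp A) x xs])
  /\
  (non_enlargeable T -> forall (x : X) (xs : dual X), T (x, xs) ->
     perp (perp (untranslate T x xs)) = untranslate T x xs /\
     (forall A : set (X * dual X), perp A = untranslate T x xs ->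
        A `<=` perp (untranslate T x xs))).
Proof.
split; first split.
- move=> neT; have [[x xs] Tx] := maximal_monotone_nonempty _ hT.
  have [biperp sc] := untranslate_biperp hX _ _ _ hT.1 neT Tx.
  exists (perp (untranslate T x xs)), x, xs; rewrite biperp translateK.
  by split=> //; exact: untranslate_maximal_monotone.
- move=> [A [x [xs [scA mA ->]]]]; apply: non_enlargeable_translate.
  exact: perp_non_enlargeable.
- move=> neT x xs Tx; split; first exact: (untranslate_biperp hX _ _ _ hT.1 neT Tx).1.
  (* With the translate rewritten as [perp A], the claim is that [A] lies in its own
     biorthogonal. *)
  by move=> A <- p Ap q Aq; rewrite -/(polar q p) polarC; exact: Aq.
Qed.
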